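(* Let $n=2m$ be even. Suppose $(\beta,\omega,\zeta)$ corresponds to a geodesic of $\mathsf{SL}(n)$ with the HS metric and satisfies the block diagonal assumption, with component functions $b_0,b_1,b_2,w_0,w_1,w_2:\mathbb{R}\to\mathbb{R}^m$ and $z\in\mathbb{R}^m$, such that $b_1=w_1=b_2=w_2=0$ at some time, and such that $z_i\ne0$ for every $i$. Suppose further that, at some time $t$, there exists $1\le m_0<m$ such that \[0\ne|z_1|=\cdots=|z_{m_0}|,\qquad |z_{m_0+1}|=\cdots=|z_m|\neq0,\] \[b_{0,1}=\cdots=b_{0,m_0},\qquad b_{0,m_0+1}=\cdots=b_{0,m},\] \[w_{0,1}=\cdots=w_{0,m_0},\qquad w_{0,m_0+1}=\cdots=w_{0,m}.\] Then these conditions are preserved for all time and the solution $(\beta,\omega,\zeta)$ is periodic in time.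
   Context: $\mathcal{M}(n)$ is the space of real $n\times n$ matrices with the Hilbert-Schmidt inner product $\langle A,B\rangle=\operatorname{tr}(AB^T)$; the HS metric on $\mathsf{SL}(n)=\{\det A=1\}$ is the induced Riemannian metric. A curve $A(t)$ in $\mathsf{SL}(n)$ is a geodesic iff $A''=\frac{\operatorname{tr}(A'A^{-1}A'A^{-1})}{\operatorname{tr}(A^{-1}A^{-T})}A^{-T}$. To a geodesic $A(t)$ one associates \[\beta=A^{-1}A^{-T},\quad \omega=A^TA'+(A^T)'A,\quad \zeta=A^TA'-(A^T)'A.\] Then $\beta$ is symmetric positive definite with determinant 1, $\omega$ is symmetric with $\operatorname{tr}(\beta\omega)=0$, $\zeta$ is antisymmetric, and they satisfy \[\beta'=-\beta\omega\beta,\quad \zeta'=0,\quad \omega'=\tfrac12(\omega+\zeta)^T\beta(\omega+\zeta)+\tfrac12\frac{\operatorname{tr}\omega\beta\omega\beta}{\operatorname{tr}\beta}I+\tfrac12\frac{\operatorname{tr}\zeta\beta\zeta\beta}{\operatorname{tr}\beta}I.\] Write $I_2$ for the $2\times2$ identity, $K_2=\begin{pmatrix}1&0\\0&-1\end{pmatrix}$, $S_2=\begin{pmatrix}0&1\\1&0\end{pmatrix}$, $Z_2=\begin{pmatrix}0&-1\\1&0\end{pmatrix}$, and $\oplus$ for block-diagonal sum. Block diagonal assumption for $n=2m$: there are functions $b_0,b_1,b_2,w_0,w_1,w_2:\mathbb{R}\to\mathbb{R}^m$ and a fixed $z\in\mathbb{R}^m$ with \[\beta=\bigoplus_{i=1}^m(b_{0,i}I_2+b_{1,i}K_2+b_{2,i}S_2),\quad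 \zeta=\bigoplus_{i=1}^m z_iZ_2,\quad \omega=\bigoplus_{i=1}^m(w_{0,i}I_2+w_{1,i}K_2+w_{2,i}S_2),\] and $b_0\cdot w_0+b_1\cdot w_1+b_2\cdot w_2=0$. *)

(* Defs.v *)
From HB Require Import structures.
From mathcomp Require Import all_boot all_order all_algebra.
From mathcomp Require Import all_classical all_reals all_analysis.

Set Implicit Arguments.
Unset Strict Implicit.
Unset Printing Implicit Defensive.

Import Order.TTheory GRing.Theory Num.Theory.
Import numFieldNormedType.Exports.

Local Open Scope ring_scope.

Section Geodesics.
Variables (R : realType) (n : nat).
Implicit Type A : R -> 'M[R]_n.

(* The equation says that A'' is normal to SL(n) at A(t), for the inner
   product tr(X Y^T). SL(n) is closed in the space of matrices, hence complete,
   so that geodesics are taken to be defined on all of R. *)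
Definition SL_geodesic A : Prop :=
  [/\ forall t, \det (A t) = 1,
      forall t, derivable A t 1,
      forall t, derivable (derive1 A) t 1
    & forall t, let V := derive1 A t in let Ai := invmx (A t) in
        derive1 (derive1 A) t =
          (\tr (V *m Ai *m V *m Ai) / \tr (Ai *m Ai^T)) *: Ai^T].

Definition geo_beta A (t : R) : 'M[R]_n := invmx (A t) *m (invmx (A t))^T.

Definition geo_omega A (t : R) : 'M[R]_n :=
  (A t)^T *m derive1 A t + (derive1 A t)^T *m A t.

Definition geo_zeta A (t : R) : 'M[R]_n :=
  (A t)^T *m derive1 A t - (derive1 A t)^T *m A t.

End Geodesics.

Section Blocks.
Variable R : realType.

Definition mat2 (a b c d : R) : 'M[R]_2 :=
  block_mx a%:M b%:M c%:M d%:M : 'M[R]_(1 + 1).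

Definition I2 : 'M[R]_2 := 1%:M.
Definition K2 : 'M[R]_2 := mat2 1 0 0 (-1).
Definition S2 : 'M[R]_2 := mat2 0 1 1 0.
Definition Z2 : 'M[R]_2 := mat2 0 (-1) 1 0.

Lemma sum_blocks2 (m : nat) : (\sum_(i < m) 2 = 2 * m)%N.
Proof. by rewrite sum_nat_const card_ord mulnC. Qed.

(* mxdiag has size \sum_(i < m) 2; the cast identifies it with 2 * m. *)
Definition blocks2 (m : nat) (B : 'I_m -> 'M[R]_2) : 'M[R]_(2 * m) :=
  castmx (sum_blocks2 m, sum_blocks2 m) (\mxdiag_(i < m) B i).

Definition sym_blocks (m : nat) (x0 x1 x2 : 'rV[R]_m) : 'M[R]_(2 * m) :=
  blocks2 (fun i => x0 0 i *: I2 + x1 0 i *: K2 + x2 0 i *: S2).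

Definition skew_blocks (m : nat) (z : 'rV[R]_m) : 'M[R]_(2 * m) :=
  blocks2 (fun i => z 0 i *: Z2).

Definition dotv (m : nat) (x y : 'rV[R]_m) : R := \sum_(i < m) x 0 i * y 0 i.

Definition block_diagonal (m : nat) (beta omega zeta : R -> 'M[R]_(2 * m))
    (b0 b1 b2 w0 w1 w2 : R -> 'rV[R]_m) (z : 'rV[R]_m) : Prop :=
  forall t,
    [/\ beta t = sym_blocks (b0 t) (b1 t) (b2 t),
        zeta t = skew_blocks z,
        omega t = sym_blocks (w0 t) (w1 t) (w2 t)
      & dotv (b0 t) (w0 t) + dotv (b1 t) (w1 t) + dotv (b2 t) (w2 t) = 0].

(* The first m0 entries of x are equal to each other, and so are the others. *)
Definition two_groups (m m0 : nat) (x : 'rV[R]_m) : Prop :=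
  forall i j : 'I_m, (i < m0)%N = (j < m0)%N -> x 0 i = x 0 j.

End Blocks.

(* Main.v *)
(** The diagonal blocks of [G = A^T A = beta^-1] satisfy [G' = omega] and an
    equation for [omega'] in which the blocks interact only through a common
    multiple [mu] of the identity. The [K2] and [S2] components of a block solve
    a homogeneous linear system, and so do the differences between two blocks
    with the same [|z_i|]; by Gronwall they vanish as soon as they vanish
    once. What remains are the two entries [a] and [b] of the scalar blocks of
    [G], tied by [p a'/a + q b'/b = 0]: one degree of freedom. Its potential
    energy [p z1^2 / a + q z2^2 / b] is strictly convex and coercive in [ln a],
    so that the velocity vanishes at arbitrarily large times. By uniqueness the
    solution is symmetric about each such time, and two such symmetries compose
    to a period. *)

Require Import Defs.
From HB Require Import structures.
From mathcomp Require Import all_boot all_order all_algebra.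
From mathcomp Require Import all_classical all_reals all_analysis.
From mathcomp Require Import ring lra.

Import Order.TTheory GRing.Theory Num.Theory.
Import numFieldNormedType.Exports.

Local Open Scope ring_scope.

(* [is_derive] is a class, so that [apply:] would let instance search choose
   the derivative when it is an existential variable. *)
Definition has_derivative {R : realType} (f : R -> R) (t a : R) : Prop :=
  is_derive t 1 f a.

(** * Rules for derivatives and continuity of real functions *)

Section Calculus.
Context {R : realType}.
Implicit Types (f g : R -> R) (t a b c : R).

Lemma derE f t a b : has_derivative f t a -> a = b -> has_derivative f t b.
Proof. by move=> ? <-. Qed.

Lemma derD f g t a b : has_derivative f t a -> has_derivative g t b ->
  has_derivative (fun s => f s + g s) t (a + b).
Proof. by move=> fa gb; exact: (is_deriveD fa gb). Qed.

Lemma derN f t a : has_derivative f t a ->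
  has_derivative (fun s => - f s) t (- a).
Proof. by move=> fa; exact: (is_deriveN fa). Qed.

Lemma derM f g t a b : has_derivative f t a -> has_derivative g t b ->
  has_derivative (fun s => f s * g s) t (a * g t + f t * b).
Proof.
move=> fa gb; apply: (is_derive_eq (@is_deriveM _ _ f g t 1 a b fa gb)).
by rewrite /GRing.scale /=; ring.
Qed.

Lemma derV f t a : f t != 0 -> has_derivative f t a ->
  has_derivative (fun s => (f s)^-1) t (- a / f t ^+ 2).
Proof.
move=> ft0 fa; apply: (is_derive_eq (is_deriveV ft0 fa)).
by rewrite /GRing.scale /= mulrC mulrN mulNr.
Qed.

Lemma derC c t : has_derivative (fun=> c) t 0.
Proof. exact: is_derive_cst. Qed.

Lemma der_sum n (f : 'I_n -> R -> R) t (a : 'I_n -> R) :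
  (forall i, has_derivative (f i) t (a i)) ->
  has_derivative (fun s => \sum_i f i s) t (\sum_i a i).
Proof.
move=> fa; have -> : (fun s => \sum_i f i s) = \sum_i f i.
  by apply/funext => s; rewrite fct_sumE.
exact: is_derive_sum.
Qed.

Lemma derId t : has_derivative (fun s => s) t 1.
Proof. exact: is_derive_id. Qed.

Lemma der_comp f g t a b : has_derivative f (g t) a -> has_derivative g t b ->
  has_derivative (fun s => f (g s)) t (b * a).
Proof.
by move=> fa gb; rewrite mulrC; exact: (is_derive1_comp fa gb).
Qed.

Lemma der_refl f c t a : has_derivative f (c - t) a ->
  has_derivative (fun s => f (c - s)) t (- a).
Proof.
move=> fa; apply: derE.
  apply: (der_comp f (fun s => c - s)); first exact: fa.
  by apply: derD; [exact: derC|apply: derN; exact: derId].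
by rewrite add0r mulN1r.
Qed.

Lemma contD f g : continuous f -> continuous g ->
  continuous (fun s => f s + g s).
Proof. by move=> fc gc t; apply: cvgD; [exact: fc|exact: gc]. Qed.

Lemma contM f g : continuous f -> continuous g ->
  continuous (fun s => f s * g s).
Proof. by move=> fc gc t; apply: cvgM; [exact: fc|exact: gc]. Qed.

Lemma contN f : continuous f -> continuous (fun s => - f s).
Proof. by move=> fc t; apply: cvgN; exact: fc. Qed.

Lemma contV f : (forall t, f t != 0) -> continuous f ->
  continuous (fun s => (f s)^-1).
Proof. by move=> f0 fc t; apply: cvgV; [exact: f0|exact: fc]. Qed.

Lemma contC c : continuous (fun _ : R => c).
Proof. by move=> t; exact: cvg_cst. Qed.

Lemma cont_sum n (f : 'I_n -> R -> R) : (forall i, continuous (f i)) ->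
  continuous (fun s => \sum_i f i s).
Proof. by move=> fc; apply: continuous_big => //; exact: add_continuous. Qed.

Lemma cont_refl f c : continuous f -> continuous (fun s => f (c - s)).
Proof.
move=> fc t; apply: continuous_comp; last exact: fc.
by apply: (contD (fun=> c)); [exact: contC|apply: contN => s; exact: cvg_id].
Qed.

Lemma contX f n : continuous f -> continuous (fun s => f s ^+ n).
Proof.
move=> fc; elim: n => [|n IH]; first exact: contC.
by under eq_fun do rewrite exprS; apply: contM.
Qed.

End Calculus.

Set Implicit Arguments.
Unset Strict Implicit.

(** * Uniqueness of derivatives and the mean value theorem *)

Section MeanValue.
Context {R : realType}.
Implicit Types (f g : R -> R) (t a b c : R).

Lemma der_unique f t a b :
  has_derivative f t a -> has_derivative f t b -> a = b.
Proof. by case=> _ <- [_ <-]. Qed.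

Lemma der_continuous_at f t a : has_derivative f t a -> {for t, continuous f}.
Proof.
by move=> fa; apply/differentiable_continuous/derivable1_diffP; case: fa.
Qed.

Lemma der_continuous f df :
  (forall t, has_derivative f t (df t)) -> continuous f.
Proof.
by move=> fd t; exact: der_continuous_at (fd t).
Qed.

Lemma mean_value f df a b : a <= b ->
  (forall t, a <= t <= b -> has_derivative f t (df t)) ->
  exists2 c, a <= c <= b & f b - f a = df c * (b - a).
Proof.
move=> ab fd; have [||c] := @MVT_segment R f df a b ab.
- by move=> t /itvP tab; apply: fd; rewrite !tab.
- apply: derivable_within_continuous => t; rewrite in_itv => /= tab.
  by case: (fd t tab).
- by rewrite in_itv => cab fE; exists c.
Qed.

End MeanValue.

Ltac der := repeat first
  [ match goal with H : _ |- _ => exact: H end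
  | exact: derC | exact: derId | apply: derD | apply: derN
  | apply: derM | apply: derV ].

(* Syntactic matching: unification failures between ring operations are slow. *)
Ltac cont := lazymatch goal with
  | H : continuous ?f |- continuous ?f => exact H
  | |- continuous (fun _ => ?c) => exact: contC
  | |- continuous (fun s => @?f s + @?g s) => refine (contD f g _ _); cont
  | |- continuous (fun s => - @?f s) => refine (contN f _); cont
  | |- continuous (fun s => @?f s * @?g s) => refine (contM f g _ _); cont
  | |- continuous (fun s => @?f s ^+ 2) => refine (contX f 2 _); cont
  | |- continuous (fun s => (@?f s)^-1) =>
      refine (contV f _ _); [assumption|cont]
  | |- continuous (fun s => ?f (?c - s)) => refine (cont_refl f c _); cont
  | |- continuous (fun s => ?f s) => change (continuous f); assumption
  | |- _ => idtac
  end.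

(** * Homogeneous linear differential systems and Gronwall's argument *)

Section LinearODE.
Context {R : realType} {n : nat}.

(** On [[t0, t1]] the squared norm [f] of the solution satisfies [f' <= L f]. Hence
    [f t * expR (- (L * t))] does not increase; it starts at 0 and stays nonnegative, so it
    vanishes. *)
Lemma linear_ode_ge (x : 'I_n -> R -> R) (M : 'I_n -> 'I_n -> R -> R) (t0 : R) :
  (forall i j, continuous (M i j)) ->
  (forall i t, has_derivative (x i) t (\sum_j M i j t * x j t)) ->
  (forall i, x i t0 = 0) -> forall i t, t0 <= t -> x i t = 0.
Proof.
move=> Mc dx x0 i0 t1 t01.
have [K MK] : exists K : R, forall i j t, t0 <= t <= t1 -> `|M i j t| <= K.
  (* The sum of all the absolute values is continuous and dominates each of them, so its maximum on
     the compact interval bounds every coefficient. *)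
  pose N t := \sum_i \sum_j `|M i j t|.
  have Nc : continuous N.
    apply: cont_sum => i; apply: cont_sum => j t.
    by apply: cvg_norm; exact: Mc.
  have [c _ Ncmax] := EVT_max t01 (continuous_subspaceT Nc).
  exists (N c) => i j t tt; apply: le_trans (Ncmax t _); last by rewrite in_itv.
  rewrite /N (bigD1 i) //= (bigD1 j) //= -addrA lerDl addr_ge0 //.
    by apply: sumr_ge0.
  by apply: sumr_ge0 => k _; apply: sumr_ge0.
pose f t := \sum_i x i t * x i t.
pose df t := \sum_i (\sum_j (M i j t * x j t) * x i t *+ 2).
have fd t : has_derivative f t (df t).
  apply: derE.
    by apply: der_sum => i; exact: (derM _ _ _ _ _ (dx i t) (dx i t)).
  apply: eq_bigr => i _; rewrite sumrMnl -mulr_suml; ring.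
have f_ge0 t : 0 <= f t by apply: sumr_ge0 => i _; rewrite -expr2 sqr_ge0.
(* Each product [2 M_ij x_i x_j] is at most [K (x_i^2 + x_j^2)]; summing over all pairs gives
   [2 n K f]. *)
pose L : R := K * n%:R *+ 2.
have dfL t : t0 <= t <= t1 -> df t <= L * f t.
  move=> tt.
  have -> : L * f t = \sum_i \sum_(j < n) (K * (x i t * x i t + x j t * x j t)).
    under eq_bigr do
      rewrite -mulr_sumr big_split /= sumr_const card_ord -/(f t).
    rewrite -mulr_sumr big_split /= sumr_const card_ord sumrMnl -/(f t).
    by rewrite /L; move: (f t) => ft; ring.
  apply: ler_sum => i _; apply: ler_sum => j _.
  have := MK i j t tt; rewrite ler_norml => /andP[K1 K2].
  have s1 := sqr_ge0 (x i t + x j t); have s2 := sqr_ge0 (x i t - x j t).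
  (* By polarization this sum is twice the difference between the two sides of the goal. *)
  have : 0 <= (K - M i j t) * (x i t + x j t) ^+ 2
      + (K + M i j t) * (x i t - x j t) ^+ 2.
    by apply: addr_ge0; apply: mulr_ge0; lra.
  by rewrite !expr2; lra.
pose g t := f t * expR (- (L * t)).
have gd t : has_derivative g t ((df t - L * f t) * expR (- (L * t))).
  apply: derE.
    apply: derM; first exact: fd.
    apply: (der_comp expR (fun t => - (L * t))); first exact: is_derive_expR.
    by der.
  by rewrite /=; move: (f t) (df t) (expR _) => ? ? ?; ring.
have [c' cc] := mean_value t01 (fun t _ => gd t).
have f0 : f t0 = 0 by rewrite /f big1 // => i _; rewrite x0 mulr0.
rewrite {2}/g f0 mul0r subr0 => gE.
have : g t1 <= 0.
  rewrite gE mulr_le0_ge0 ?subr_ge0 // mulr_le0_ge0 ?expR_ge0 //.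
  by rewrite subr_le0 dfL.
rewrite /g pmulr_lle0 ?expR_gt0 // => f1.
have /eqP : f t1 = 0 by apply/eqP; rewrite eq_le f1 f_ge0.
rewrite /f psumr_eq0 => [/allP/(_ i0)|i _]; last by rewrite -expr2 sqr_ge0.
by rewrite mem_index_enum -expr2 sqrf_eq0 => /(_ isT)/eqP.
Qed.

Lemma linear_ode_eq0 (x : 'I_n -> R -> R) (M : 'I_n -> 'I_n -> R -> R)
    (t0 : R) :
  (forall i j, continuous (M i j)) ->
  (forall i t, has_derivative (x i) t (\sum_j M i j t * x j t)) ->
  (forall i, x i t0 = 0) -> forall i t, x i t = 0.
Proof.
move=> Mc dx x0 i t; have [tt|/ltW tt] := leP t0 t.
  exact: (linear_ode_ge (x := x) (M := M) (t0 := t0)).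
(* Times before [t0] are reached by reversing time. The reflection is written [0 - s], the form that
   [cont_refl] and [der_refl] handle. *)
rewrite -[t](subKr 0); apply: (linear_ode_ge (x := fun i s => x i (0 - s))
  (M := fun i j s => - M i j (0 - s)) (t0 := 0 - t0)) => //.
- by move=> j k; cont; exact: Mc.
- move=> j s; apply: derE; first by apply: der_refl; exact: dx.
  by rewrite -sumrN; apply: eq_bigr => k _; rewrite mulNr.
- by move=> j; rewrite subKr.
- by lra.
Qed.

End LinearODE.

(** * Zeros of the velocity in one-dimensional motion *)

Section TurningPoints.
Context {R : realType}.
Implicit Types (x v k h M n : R -> R) (s t B : R).

Lemma der_ge0_le f df a b : a <= b ->
  (forall t, a <= t <= b -> @has_derivative R f t (df t)) ->
  (forall t, a <= t <= b -> 0 <= df t) -> f a <= f b.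
Proof.
move=> ab fd df0; have [c cab fE] := mean_value ab fd.
by rewrite -subr_ge0 fE mulr_ge0 ?subr_ge0 ?df0.
Qed.

Lemma der_ge_le f df a b c : a <= b ->
  (forall t, a <= t <= b -> @has_derivative R f t (df t)) ->
  (forall t, a <= t <= b -> c <= df t) -> f a + c * (b - a) <= f b.
Proof.
move=> ab fd df0; have [d dab fE] := mean_value ab fd.
rewrite addrC -lerBrDr fE; apply: ler_wpM2r; first by rewrite subr_ge0.
exact: df0.
Qed.

(* If the velocity stayed positive, then either the force [- h] is eventually
   bounded away from 0 against the motion, and the square root of the kinetic
   energy [k] decreases linearly, or the kinetic energy never decreases and [x]
   grows linearly. *)
Lemma velocity_not_pos x v k h M n B C s :
  (forall t, has_derivative x t (v t)) ->
  (forall t, has_derivative k t (- (v t * h t))) ->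
  (forall t, has_derivative h t (v t * n t)) ->
  (forall t, k t = M t * v t ^+ 2) ->
  (forall t, 0 < M t <= C) -> (forall t, 0 < n t) ->
  (forall t, `|x t| <= B) ->
  ~ (forall t, s <= t -> 0 < v t).
Proof.
move=> dx dk dh kE MM n_gt0 xB v_gt0.
have C_gt0 : 0 < C by have /andP[? ?] := MM 0; lra.
have k_gt0 t : s <= t -> 0 < k t.
  move=> st; have /andP[? _] := MM t.
  by rewrite kE mulr_gt0 // exprn_gt0 // v_gt0.
have kC t : s <= t -> k t <= C * v t ^+ 2.
  by move=> st; have /andP[_ ?] := MM t; rewrite kE ler_wpM2r // sqr_ge0.
have [[t1 st1 ht1]|hneg] := pselect (exists2 t, s <= t & 0 <= h t).
  have h_gt0 t : t1 < t -> h t1 < h t.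
    move=> t1t.
    have [c /andP[t1c ct]] := mean_value (ltW t1t) (fun u _ => dh u).
    rewrite -subr_gt0 => ->; rewrite mulr_gt0 ?subr_gt0 //.
    by apply: mulr_gt0 => //; apply: v_gt0; lra.
  (* [h t1] may be 0, but [h] increases strictly, so it is positive one unit later. Since
     [Num.sqrt (k t)] is at most [Num.sqrt C * v t], its rate of decrease [v h / (2 sqrt k)] is then
     at least [c]. *)
  pose t2 := t1 + 1; pose c := h t2 / (2 * Num.sqrt C).
  have h2 : 0 < h t2 by apply: le_lt_trans ht1 (h_gt0 _ _); rewrite /t2; lra.
  have sC : 0 < Num.sqrt C by rewrite sqrtr_gt0.
  have c_gt0 : 0 < c by rewrite divr_gt0 // mulr_gt0.
  have hge t : t2 <= t -> h t2 <= h t.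
    move=> t2t; apply: (der_ge0_le t2t (fun u _ => dh u)) => u /andP[ut _].
    by rewrite mulr_ge0 // ltW // v_gt0; move: ut; rewrite /t2; lra.
  have dy t : t2 <= t -> has_derivative (fun t => - Num.sqrt (k t)) t
      (v t * h t / (2 * Num.sqrt (k t))).
    move=> t2t; have kt : 0 < k t by apply: k_gt0; move: t2t; rewrite /t2; lra.
    apply: derE.
      apply: derN; apply: (der_comp Num.sqrt k); last exact: dk.
      exact: is_derive1_sqrt.
    by rewrite mulNr opprK.
  have yc t : t2 <= t -> c <= v t * h t / (2 * Num.sqrt (k t)).
    move=> t2t; have st : s <= t by move: t2t; rewrite /t2; lra.
    have vt := v_gt0 _ st; have kt := k_gt0 _ st.
    have skt : 0 < Num.sqrt (k t) by rewrite sqrtr_gt0.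
    have skM : Num.sqrt (k t) <= Num.sqrt C * v t.
      rewrite -[v t]gtr0_norm // -sqrtr_sqr -sqrtrM; last exact: ltW.
      by apply: ler_wsqrtr; exact: kC.
    rewrite /c ler_pdivrMr ?mulr_gt0 // mulrAC ler_pdivlMr ?mulr_gt0 //.
    have := hge _ t2t.
    have : 0 <= (h t - h t2) * v t * Num.sqrt C.
      by rewrite mulr_ge0 ?(ltW sC) // mulr_ge0 ?(ltW vt) // subr_ge0 hge.
    have : 0 <= h t2 * (Num.sqrt C * v t - Num.sqrt (k t)).
      by rewrite mulr_ge0 ?(ltW h2) // subr_ge0.
    by lra.
  (* Decreasing at rate at least [c], the square root of [k] would be at most [- c] at this time. *)
  pose t3 := t2 + Num.sqrt (k t2) / c + 1.
  have t23 : t2 <= t3.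
    have : 0 <= Num.sqrt (k t2) / c.
      by rewrite divr_ge0 ?sqrtr_ge0 // (ltW c_gt0).
    by rewrite /t3; lra.
  have := der_ge_le t23 (fun t tt => dy t (proj1 (andP tt)))
    (fun t tt => yc t (proj1 (andP tt))).
  have -> : c * (t3 - t2) = Num.sqrt (k t2) + c.
    by rewrite /t3; field; rewrite gt_eqF.
  by have := sqrtr_ge0 (k t3); lra.
have h_lt0 t : s <= t -> h t < 0.
  by move=> st; rewrite ltNge; apply/negP => ht; apply: hneg; exists t.
have kge t : s <= t -> k s <= k t.
  move=> st; apply: (der_ge0_le st (fun u _ => dk u)) => u /andP[su _].
  by rewrite -mulrN mulr_ge0 ?oppr_ge0 // ltW ?v_gt0 ?h_lt0.
(* From [k s <= k t <= C * v t ^+ 2], this is a lower bound on the velocity. *)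
pose c := Num.sqrt (k s / C).
have c_gt0 : 0 < c by rewrite sqrtr_gt0 divr_gt0 ?k_gt0.
have cv t : s <= t -> c <= v t.
  move=> st; rewrite -[v t]gtr0_norm ?v_gt0 // -sqrtr_sqr.
  apply: ler_wsqrtr; rewrite ler_pdivrMr // mulrC.
  exact: le_trans (kge _ st) (kC _ st).
have B_ge0 : 0 <= B by apply: le_trans (xB 0).
(* By this time [x] has grown by at least [2 * B + 1], whereas [|x| <= B] allows only [2 * B]. *)
pose t3 := s + (2 * B + 1) / c.
have st3 : s <= t3.
  have : 0 <= (2 * B + 1) / c by rewrite divr_ge0 ?(ltW c_gt0) //; lra.
  by rewrite /t3; lra.
have := der_ge_le st3 (fun t _ => dx t)
  (fun t tt => cv t (proj1 (andP tt))).
have -> : c * (t3 - s) = 2 * B + 1 by rewrite /t3; field; rewrite gt_eqF.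
have := xB s; have := xB t3; rewrite !ler_norml => /andP[_ ?] /andP[? _].
by lra.
Qed.

(** If [v] had no zero after [s], it would keep one sign by the intermediate value theorem. The
    negative case becomes the positive one on changing the signs of [x], [v] and [h], which leaves
    [k], [M] and [n] as they are. *)
Lemma turning_point x v k h M n B C s :
  continuous v ->
  (forall t, has_derivative x t (v t)) ->
  (forall t, has_derivative k t (- (v t * h t))) ->
  (forall t, has_derivative h t (v t * n t)) ->
  (forall t, k t = M t * v t ^+ 2) ->
  (forall t, 0 < M t <= C) -> (forall t, 0 < n t) ->
  (forall t, `|x t| <= B) ->
  exists2 t, s <= t & v t = 0.
Proof.
move=> vc dx dk dh kE MM n_gt0 xB; apply: contrapT => vN0.
have v0 t : s <= t -> v t != 0.
  by move=> st; apply/eqP => v0; apply: vN0; exists t.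
have vsign t u : s <= t <= u -> v t * v u < 0 -> False.
  move=> /andP[st tu] vtu.
  have [|c] := @IVT R v t u 0 tu (continuous_subspaceT vc).
    by rewrite ge_min le_max; nra.
  by rewrite in_itv /= => /andP[tc _] /eqP; apply/negP/v0/(le_trans st).
have := v0 s (lexx s); rewrite neq_lt => /orP[vs|vs].
- apply: (@velocity_not_pos (fun t => - x t) (fun t => - v t) k (fun t => - h t)
    M n B C s) => //.
  + by move=> t; apply: derN; exact: dx.
  + by move=> t; apply: derE; [exact: dk|rewrite mulrNN].
  + by move=> t; apply: derE; [apply: derN; exact: dh|rewrite mulNr].
  + by move=> t; rewrite sqrrN.
  + by move=> t; rewrite normrN.
  move=> t st; rewrite oppr_gt0; have := v0 _ st; rewrite neq_lt => /orP[//|vt].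
  by case: (vsign s t); [rewrite lexx|rewrite nmulr_rlt0].
- apply: (@velocity_not_pos x v k h M n B C s) => // t st.
  have := v0 _ st; rewrite neq_lt => /orP[vt|//].
  by case: (vsign s t); [rewrite lexx|rewrite pmulr_rlt0].
Qed.

End TurningPoints.

(** * The reduced system with one degree of freedom *)

Section TwoBody.
Context {R : realType}.
Variables (r y1 y2 : R).
Hypotheses (r_gt0 : 0 < r) (y1_gt0 : 0 < y1) (y2_gt0 : 0 < y2).
Implicit Types (a b v : R -> R).

(* Here [v = (ln a)'] and [(ln b)' = - r v]; the formula is the equation of
   motion once the multiplier enforcing this constraint has been eliminated. *)
Definition two_body_force (a b v : R) : R :=
  (y1 / a - y2 / b - (a - r ^+ 2 * b) * v ^+ 2) / (2 * (a + r * b)).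

Definition two_body a b v : Prop := forall t,
  [/\ 0 < a t /\ 0 < b t,
      has_derivative a t (v t * a t),
      has_derivative b t (- (r * v t * b t)) &
      has_derivative v t (two_body_force (a t) (b t) (v t))].

(** The differences [a - a'], [b - b'], [v - v'] solve a homogeneous linear system whose
    coefficients, difference quotients of the right-hand sides, are continuous along the two given
    solutions. *)
Lemma two_body_unique a b v a' b' v' s :
  two_body a b v -> two_body a' b' v' ->
  a s = a' s -> b s = b' s -> v s = v' s ->
  forall t, [/\ a t = a' t, b t = b' t & v t = v' t].
Proof.
move=> sol sol' as_ bs vs.
have a_gt0 t : 0 < a t by have [[]] := sol t.
have b_gt0 t : 0 < b t by have [[]] := sol t.
have a'_gt0 t : 0 < a' t by have [[]] := sol' t.
have b'_gt0 t : 0 < b' t by have [[]] := sol' t.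
have da t : has_derivative a t (v t * a t) by have [] := sol t.
have db t : has_derivative b t (- (r * v t * b t)) by have [] := sol t.
have dv t : has_derivative v t (two_body_force (a t) (b t) (v t))
  by have [] := sol t.
have da' t : has_derivative a' t (v' t * a' t) by have [] := sol' t.
have db' t : has_derivative b' t (- (r * v' t * b' t)) by have [] := sol' t.
have dv' t : has_derivative v' t (two_body_force (a' t) (b' t) (v' t))
  by have [] := sol' t.
have ca := der_continuous da; have cb := der_continuous db.
have cv := der_continuous dv; have ca' := der_continuous da'.
have cb' := der_continuous db'; have cv' := der_continuous dv'.
have a0 t : a t != 0 by rewrite gt_eqF.
have b0 t : b t != 0 by rewrite gt_eqF.
have a'0 t : a' t != 0 by rewrite gt_eqF.
have b'0 t : b' t != 0 by rewrite gt_eqF.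
have M_gt0 t : 0 < a t + r * b t by rewrite addr_gt0 // mulr_gt0.
have M'_gt0 t : 0 < a' t + r * b' t by rewrite addr_gt0 // mulr_gt0.
have M0 t : 2 * (a t + r * b t) != 0 by rewrite gt_eqF // mulr_gt0.
have M'0 t : 2 * (a' t + r * b' t) != 0 by rewrite gt_eqF // mulr_gt0.
have N0 t : a t + r * b t != 0 by rewrite gt_eqF.
have N'0 t : a' t + r * b' t != 0 by rewrite gt_eqF.
pose F' t := two_body_force (a' t) (b' t) (v' t).
have cF' : continuous F' by rewrite /F' /two_body_force; cont.
pose x (i : 'I_3) := nth (fun=> 0)
  [:: fun t => a t - a' t; fun t => b t - b' t; fun t => v t - v' t] i.
(* For the last row, write the force as [F = N / D] with [D = 2 (a + r b)]. Then
   [D (F - F') = (N - N') - (D - D') F'], and each difference on the right is linear in the three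
   unknowns. The defaults of [nth] are never reached. *)
pose M (i j : 'I_3) := nth (fun=> 0) (nth [::]
  [:: [:: v; fun=> 0; a'];
      [:: fun=> 0; fun t => - (r * v t); fun t => - (r * b' t)];
      [:: fun t => (- (y1 * (a t)^-1 * (a' t)^-1) - v t ^+ 2 - 2 * F' t)
                   * (2 * (a t + r * b t))^-1;
          fun t => (y2 * (b t)^-1 * (b' t)^-1 + r ^+ 2 * v t ^+ 2
                    - 2 * r * F' t) * (2 * (a t + r * b t))^-1;
          fun t => - ((a' t - r ^+ 2 * b' t) * (v t + v' t)
                      * (2 * (a t + r * b t))^-1)]] i) j.
have x0 := linear_ode_eq0 (x := x) (M := M) (t0 := s).
have {}x0 : forall i t, x i t = 0.
  apply: x0.
  - by case=> [[|[|[|//]]] i3]; case=> [[|[|[|//]]] j3]; rewrite /M /=; cont.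
  - case=> [[|[|[|//]]] i3] t; rewrite !big_ord_recl big_ord0 /x /M /=.
    + apply: derE; first by apply: derD; [exact: da|apply: derN; exact: da'].
      by ring.
    + apply: derE; first by apply: derD; [exact: db|apply: derN; exact: db'].
      by ring.
    + apply: derE; first by apply: derD; [exact: dv|apply: derN; exact: dv'].
      rewrite /F' /two_body_force; move: (a0 t) (b0 t) (a'0 t) (b'0 t).
      move: (N0 t) (N'0 t).
      move: (a t) (b t) (v t) (a' t) (b' t) (v' t) => A B V A' B' V' *.
      by field; do ?(apply/andP; split).
  - by case=> [[|[|[|//]]] i3]; rewrite /x /= ?as_ ?bs ?vs subrr.
move=> t; split; apply/eqP; rewrite -subr_eq0; apply/eqP.
- exact: (x0 (@Ordinal 3 0 isT)).
- exact: (x0 (@Ordinal 3 1 isT)).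
- exact: (x0 (@Ordinal 3 2 isT)).
Qed.

(** The force depends on [v] only through its square, so reversing time about [s] and the sign of
    [v] gives another solution. As [v s = 0], both have the same data at [s]. *)
Lemma two_body_reflect a b v s : two_body a b v -> v s = 0 ->
  forall t, [/\ a t = a (2 * s - t), b t = b (2 * s - t)
              & v t = - v (2 * s - t)].
Proof.
move=> sol vs; have ss : 2 * s - s = s by lra.
apply: (two_body_unique (s := s) sol); rewrite ?ss ?vs ?oppr0 // => t.
have [[a0 b0] da db dv] := sol (2 * s - t); split => //.
- by apply: derE; [apply: der_refl; exact: da|rewrite mulNr].
- by apply: derE; [apply: der_refl; exact: db|rewrite mulrN mulNr].
- apply: derE; first by apply: derN; apply: der_refl; exact: dv.
  by rewrite opprK /two_body_force sqrrN.
Qed.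

Lemma der0_cst (f : R -> R) (t u : R) :
  (forall t, has_derivative f t 0) -> f t = f u.
Proof.
move=> df; wlog tu : t u / t <= u.
  by move=> W; have [/W//|/ltW/W] := leP t u.
have [c _ /eqP] := mean_value tu (fun t _ => df t).
by rewrite mul0r subr_eq0 => /eqP.
Qed.

(** The energy [E] and the integrated constraint [c = r ln a + ln b] are conserved. All terms of [E]
    being nonnegative, [E] bounds [1 / a] and [1 / b]; through [c], each of these lower bounds on
    [a] and [b] becomes an upper bound on the other. *)
Lemma two_body_bounded a b v : two_body a b v ->
  exists B C, forall t, `|ln (a t)| <= B /\ a t + r * b t <= C.
Proof.
move=> sol.
have a_gt0 t : 0 < a t by have [[]] := sol t.
have b_gt0 t : 0 < b t by have [[]] := sol t.
have a0 t : a t != 0 by rewrite gt_eqF.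
have b0 t : b t != 0 by rewrite gt_eqF.
have M_gt0 t : 0 < a t + r * b t by rewrite addr_gt0 // mulr_gt0.
have M0 t : a t + r * b t != 0 by rewrite gt_eqF.
pose E t := r * ((a t + r * b t) * (v t * v t)) + r * (y1 * (a t)^-1)
  + y2 * (b t)^-1.
have EE t : E t = E 0.
  apply: der0_cst => {}t; have [_ da db dv] := sol t.
  apply: derE; first by rewrite /E; der.
  rewrite /two_body_force; move: (a0 t) (b0 t) (M0 t).
  by move: (a t) (b t) (v t) => A B V *; field; do ?(apply/andP; split).
pose c t := r * ln (a t) + ln (b t).
have cE t : c t = c 0.
  apply: der0_cst => {}t; have [_ da db _] := sol t.
  apply: derE.
    apply: derD; last first.
      by apply: (der_comp (@ln R) b); [exact: is_derive1_ln|exact: db].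
    apply: derM; first exact: derC.
    by apply: (der_comp (@ln R) a); [exact: is_derive1_ln|exact: da].
  move: (a0 t) (b0 t).
  by move: (a t) (b t) (v t) => A B V *; field; do ?(apply/andP; split).
have ia t : 0 < (a t)^-1 by rewrite invr_gt0.
have ib t : 0 < (b t)^-1 by rewrite invr_gt0.
have k_ge0 t : 0 <= r * ((a t + r * b t) * (v t * v t)).
  rewrite mulr_ge0 ?(ltW r_gt0) // mulr_ge0 ?(ltW (M_gt0 t)) //.
  by rewrite -expr2 sqr_ge0.
have Pa t : 0 < r * (y1 * (a t)^-1) by rewrite !mulr_gt0.
have Pb t : 0 < y2 * (b t)^-1 by rewrite mulr_gt0.
have E_gt0 : 0 < E 0.
  by have := k_ge0 0; have := Pa 0; have := Pb 0; rewrite /E; lra.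
pose L1 := ln (E 0 / (r * y1)); pose L2 := ln (E 0 / y2).
have La t : - ln (a t) <= L1.
  rewrite -lnV ?posrE // ler_ln ?posrE ?divr_gt0 ?mulr_gt0 //.
  rewrite ler_pdivlMr ?mulr_gt0 // -(EE t).
  by have := k_ge0 t; have := Pb t; rewrite /E; lra.
have Lb t : - ln (b t) <= L2.
  rewrite -lnV ?posrE // ler_ln ?posrE ?divr_gt0 //.
  rewrite ler_pdivlMr // -(EE t).
  by have := k_ge0 t; have := Pa t; rewrite /E; lra.
pose U1 := (c 0 + L2) / r; pose U2 := c 0 + r * L1.
have Ua t : ln (a t) <= U1.
  rewrite ler_pdivlMr //; have := Lb t; have := cE t; rewrite /c; lra.
have Ub t : ln (b t) <= U2.
  have : 0 <= r * (L1 + ln (a t)).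
    by rewrite mulr_ge0 ?(ltW r_gt0) //; have := La t; lra.
  by have := cE t; rewrite /U2 /c; lra.
exists (`|U1| + `|L1|), (expR U1 + r * expR U2) => t; split.
  have := ler_norm U1; have := ler_norm L1; have := Ua t; have := La t.
  have := normr_ge0 U1; have := normr_ge0 L1.
  by rewrite ler_norml => *; apply/andP; split; lra.
rewrite lerD //; first by rewrite -(lnK (a_gt0 t)) ler_expR.
by rewrite ler_wpM2l ?(ltW r_gt0) // -(lnK (b_gt0 t)) ler_expR.
Qed.

(** In the coordinate [ln a], the inertia is [a + r * b] and the potential is [y1 / a + y2 / (r b)].
    The function [h] is the slope of this potential, and the positive factor in [h'] is its second
    derivative. *)
Lemma two_body_turning a b v s : two_body a b v ->
  exists2 t, s <= t & v t = 0.
Proof.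
move=> sol; have [B [C BC]] := two_body_bounded sol.
have a_gt0 t : 0 < a t by have [[]] := sol t.
have b_gt0 t : 0 < b t by have [[]] := sol t.
have a0 t : a t != 0 by rewrite gt_eqF.
have b0 t : b t != 0 by rewrite gt_eqF.
have M_gt0 t : 0 < a t + r * b t by rewrite addr_gt0 // mulr_gt0.
have M0 t : a t + r * b t != 0 by rewrite gt_eqF.
apply: (@turning_point _ (fun t => ln (a t)) v
  (fun t => (a t + r * b t) * (v t * v t))
  (fun t => y2 * (b t)^-1 - y1 * (a t)^-1) (fun t => a t + r * b t)
  (fun t => r * (y2 * (b t)^-1) + y1 * (a t)^-1) B C).
- pose dv t := two_body_force (a t) (b t) (v t).
  by apply: (der_continuous (df := dv)) => t; have [] := sol t.
- move=> t; have [_ da _ _] := sol t; apply: derE.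
    by apply: (der_comp (@ln R) a); [exact: is_derive1_ln|exact: da].
  by rewrite mulfK.
- move=> t; have [_ da db dv] := sol t; apply: derE; first by der.
  rewrite /two_body_force; move: (a0 t) (b0 t) (M0 t).
  by move: (a t) (b t) (v t) => ? ? ? *; field; do ?(apply/andP; split).
- move=> t; have [_ da db dv] := sol t; apply: derE; first by der.
  move: (a0 t) (b0 t) (M0 t).
  by move: (a t) (b t) (v t) => ? ? ? *; field; do ?(apply/andP; split).
- by [].
- by move=> t; rewrite M_gt0; case: (BC t).
- by move=> t; rewrite addr_gt0 ?mulr_gt0 ?invr_gt0.
- by move=> t; case: (BC t).
Qed.

(** Reflections about two zeros [s1], [s2] of [v] compose to the translation by [2 * (s2 - s1)], and
    the two changes of sign of [v] cancel. Searching for [s2] from [s1 + 1] makes the period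
    positive. *)
Lemma two_body_periodic a b v : two_body a b v ->
  exists T, [/\ 0 < T, periodic a T, periodic b T & periodic v T].
Proof.
move=> sol.
have [s1 _ v1] := two_body_turning 0 sol.
have [s2 s12 v2] := two_body_turning (s1 + 1) sol.
exists (2 * (s2 - s1)).
have refl t : 2 * s1 - (2 * s2 - (t + 2 * (s2 - s1))) = t by lra.
have R1 := two_body_reflect sol v1.
have R2 := two_body_reflect sol v2.
have shift t : [/\ a (t + 2 * (s2 - s1)) = a t, b (t + 2 * (s2 - s1)) = b t
    & v (t + 2 * (s2 - s1)) = v t].
  have [-> -> ->] := R2 (t + 2 * (s2 - s1)).
  have [-> -> ->] := R1 (2 * s2 - (t + 2 * (s2 - s1))).
  by rewrite refl opprK.
by split; [lra|move=> t|move=> t|move=> t]; have [] := shift t.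
Qed.

End TwoBody.

(** * Algebra of two-by-two matrices and diagonal blocks *)

Section Blocks.
Context {R : realType}.
Implicit Types a b c d : R.

Lemma mat2E a b c d : [/\ mat2 a b c d 0 0 = a, mat2 a b c d 0 1 = b,
  mat2 a b c d 1 0 = c & mat2 a b c d 1 1 = d].
Proof.
by split; rewrite /mat2 /block_mx !mxE; case: splitP => // k;
  rewrite ord1 // => _;
  rewrite !mxE; case: splitP => // l; rewrite ord1 // mxE.
Qed.

Lemma mat2_00 a b c d : mat2 a b c d 0 0 = a.
Proof. by case: (mat2E a b c d). Qed.

Lemma mat2_01 a b c d : mat2 a b c d 0 1 = b.
Proof. by case: (mat2E a b c d). Qed.

Lemma mat2_11 a b c d : mat2 a b c d 1 1 = d.
Proof. by case: (mat2E a b c d). Qed.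

Lemma mat2_eta (X : 'M[R]_2) : X = mat2 (X 0 0) (X 0 1) (X 1 0) (X 1 1).
Proof.
have [e00 e01 e10 e11] := mat2E (X 0 0) (X 0 1) (X 1 0) (X 1 1).
apply/matrixP => i j.
have ord2 (k : 'I_2) : k = 0 \/ k = 1.
  by case: k => [[|[|//]] k2]; [left|right]; apply/val_inj.
by case: (ord2 i) (ord2 j) => -> [] ->; rewrite ?e00 ?e01 ?e10 ?e11.
Qed.

Lemma mat2_inj a b c d a' b' c' d' : mat2 a b c d = mat2 a' b' c' d' ->
  [/\ a = a', b = b', c = c' & d = d'].
Proof.
move=> E; have := mat2E a b c d; have [] := mat2E a' b' c' d'.
by rewrite E => -> -> -> -> [].
Qed.

Lemma mat2M a b c d a' b' c' d' : mat2 a b c d *m mat2 a' b' c' d' =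
  mat2 (a * a' + b * c') (a * b' + b * d') (c * a' + d * c') (c * b' + d * d').
Proof.
apply: (etrans (@mulmx_block _ 1 1 1 1 1 1 _ _ _ _ _ _ _ _)).
by rewrite -!scalar_mxM -!raddfD.
Qed.

Lemma mat2D a b c d a' b' c' d' : mat2 a b c d + mat2 a' b' c' d' =
  mat2 (a + a') (b + b') (c + c') (d + d').
Proof.
by apply: (etrans (@add_block_mx _ 1 1 1 1 _ _ _ _ _ _ _ _)); rewrite -!raddfD.
Qed.

Lemma mat2Z k a b c d :
  k *: mat2 a b c d = mat2 (k * a) (k * b) (k * c) (k * d).
Proof.
apply: (etrans (@scale_block_mx _ 1 1 1 1 _ _ _ _ _)).
by rewrite !scale_scalar_mx.
Qed.

Lemma mat2N a b c d : - mat2 a b c d = mat2 (- a) (- b) (- c) (- d).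
Proof. by rewrite -scaleN1r mat2Z !mulN1r. Qed.

Lemma mat2_1 a : a%:M = mat2 a 0 0 a.
Proof.
by apply: (etrans (@scalar_mx_block _ 1 1 a)); rewrite /mat2 !raddf0.
Qed.

Lemma sym_blockE x0 x1 x2 :
  x0 *: @I2 R + x1 *: K2 R + x2 *: S2 R = mat2 (x0 + x1) x2 x2 (x0 - x1).
Proof. by rewrite /I2 mat2_1 /K2 /S2 !mat2Z !mat2D; congr mat2; ring. Qed.

Lemma skew_blockE z : z *: Z2 R = mat2 0 (- z) z 0.
Proof. by rewrite /Z2 mat2Z; congr mat2; ring. Qed.

Context {m : nat}.

Definition diag_block (i : 'I_m) (X : 'M[R]_(2 * m)) : 'M[R]_2 :=
  submxblock (castmx (esym (sum_blocks2 m), esym (sum_blocks2 m)) X) i i.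

Lemma diag_blockK i B : diag_block i (blocks2 B) = B i.
Proof. by rewrite /diag_block /blocks2 castmxK submxblock_diag. Qed.

Lemma castmxM n n' (e : n = n') (X Y : 'M[R]_n) :
  castmx (e, e) (X *m Y) = castmx (e, e) X *m castmx (e, e) Y.
Proof. by case: _ / e; rewrite !castmx_id.
Qed.

(** A single block diagonal factor suffices: the other blocks of [X] in row [i] meet zero blocks.
    This allows [X] to be the Gram matrix [A^T A], of which only the inverse is given as block
    diagonal. *)
Lemma diag_blockMr i X B :
  diag_block i (X *m blocks2 B) = diag_block i X *m B i.
Proof.
rewrite /diag_block castmxM /blocks2 castmxK.
set Y := castmx _ X; rewrite -{1}(submxblockK Y).
by rewrite mul_mxblock_mxdiag mxblockK.
Qed.

Lemma diag_blockMl i X B :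
  diag_block i (blocks2 B *m X) = B i *m diag_block i X.
Proof.
rewrite /diag_block castmxM /blocks2 castmxK.
set Y := castmx _ X; rewrite -{1}(submxblockK Y).
by rewrite mul_mxdiag_mxblock mxblockK.
Qed.

Lemma blocks2D B C :
  blocks2 B + blocks2 C = blocks2 (fun i => B i + C i) :> 'M[R]_(2 * m).
Proof.
by rewrite /blocks2 mxdiagD; case: _ / (sum_blocks2 m); rewrite !castmx_id.
Qed.

Lemma blocks2N B : - blocks2 B = blocks2 (fun i => - B i) :> 'M[R]_(2 * m).
Proof.
by rewrite /blocks2 mxdiagN; case: _ / (sum_blocks2 m); rewrite !castmx_id.
Qed.

Definition block_index (i : 'I_m) (j : 'I_2) : 'I_(2 * m) :=
  cast_ord (sum_blocks2 m) (@tagnat.Rank _ (fun=> 2%N) i j).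

(** Entries of a block are entries of the whole matrix, so linearity and entrywise derivatives carry
    over to blocks. *)
Lemma diag_blockE i X j k :
  diag_block i X j k = X (block_index i j) (block_index i k).
Proof.
rewrite /diag_block mxE castmxE /=.
by congr (X _ _); apply/val_inj.
Qed.

Lemma diag_blockD i X Y :
  diag_block i (X + Y) = diag_block i X + diag_block i Y.
Proof. by apply/matrixP => j k; rewrite diag_blockE 2!mxE -!diag_blockE. Qed.

Lemma diag_blockZ i c X : diag_block i (c *: X) = c *: diag_block i X.
Proof. by apply/matrixP => j k; rewrite diag_blockE 2!mxE -!diag_blockE. Qed.

Lemma diag_block_scalar i c : diag_block i c%:M = c%:M.
Proof.
rewrite -[RHS](diag_blockK i (fun=> c%:M)); congr diag_block.
by rewrite /blocks2 mxdiagZ; case: _ / (sum_blocks2 m); rewrite castmx_id.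
Qed.

End Blocks.

(** * Derivatives of the Gram matrix and of omega along a geodesic *)

Section MatrixCurves.
Context {R : realType}.

Lemma der_mx m n (F : R -> 'M[R]_(m, n)) t i j : derivable F t 1 ->
  has_derivative (fun s => F s i j) t (derive1 F t i j).
Proof.
move=> dF; rewrite derive1E derive_mx // mxE.
by apply: DeriveDef; first exact: (derivable_mxP F t 1).1.
Qed.

Lemma der_mulmx m n p (F : R -> 'M[R]_(m, n)) (G : R -> 'M[R]_(n, p)) t
    (F' : 'M[R]_(m, n)) (G' : 'M[R]_(n, p)) :
  (forall i j, has_derivative (fun s => F s i j) t (F' i j)) ->
  (forall i j, has_derivative (fun s => G s i j) t (G' i j)) ->
  forall i j, has_derivative (fun s => (F s *m G s) i j) t
    ((F' *m G t + F t *m G') i j).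
Proof.
move=> dF dG i j; under [X in has_derivative X]eq_fun do rewrite mxE.
apply: derE; first by apply: der_sum => k; apply: derM; [exact: dF|exact: dG].
by rewrite !mxE -big_split.
Qed.

Variables (n : nat) (A : R -> 'M[R]_n).
Hypothesis hA : SL_geodesic A.

Lemma geodesic_unit t : A t \in unitmx.
Proof. by have [dA _ _ _] := hA; rewrite unitmxE dA unitr1. Qed.

Lemma der_gram t i j : has_derivative (fun s => ((A s)^T *m A s) i j) t
  (geo_omega A t i j).
Proof.
have [_ dA _ _] := hA.
have dAT k l : has_derivative (fun s => (A s)^T k l) t ((derive1 A t)^T k l).
  by rewrite mxE; under eq_fun do rewrite mxE; exact: der_mx.
rewrite /geo_omega addrC.
by apply: der_mulmx => // k l; exact: der_mx.
Qed.

Lemma gram_beta t : ((A t)^T *m A t) *m geo_beta A t = 1%:M.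
Proof.
have At := geodesic_unit t.
rewrite /geo_beta mulmxA -(mulmxA _ (A t)) mulmxV // mulmx1 -trmx_mul.
by rewrite mulVmx // trmx1.
Qed.

(** The product rule gives [2 A'^T A'] plus [A^T A''] and its transpose. As [A''] is a multiple of
    [A^-T], the last two are multiples of the identity. The factors [omega - zeta = 2 A'^T A] and
    [omega + zeta = 2 A^T A'] give the first term, since beta cancels the inner [A] and [A^T]. The
    multiplier stays abstract; the constraint determines it later. *)
Lemma der_omega t : exists mu, forall i j,
  has_derivative (fun s => geo_omega A s i j) t
   ((2^-1 *: ((geo_omega A t - geo_zeta A t) *m geo_beta A t *m
              (geo_omega A t + geo_zeta A t)) + mu%:M) i j).
Proof.
have [_ dA ddA geo] := hA; have At := geodesic_unit t.
set A1 := derive1 A; set A2 := derive1 A1.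
have [mu A2E] : exists mu, A2 t = mu *: (invmx (A t))^T.
  by eexists; exact: (geo t).
exists (2 * mu) => i j.
have dAT k l : has_derivative (fun s => (A s)^T k l) t ((A1 t)^T k l).
  by rewrite mxE; under eq_fun do rewrite mxE; exact: der_mx.
have dA1T k l : has_derivative (fun s => (A1 s)^T k l) t ((A2 t)^T k l).
  by rewrite mxE; under eq_fun do rewrite mxE; exact: der_mx.
have dA1 k l : has_derivative (fun s => A1 s k l) t (A2 t k l).
  exact: der_mx.
have dA0 k l : has_derivative (fun s => A s k l) t (A1 t k l) by exact: der_mx.
rewrite /geo_omega; under [X in has_derivative X]eq_fun do rewrite mxE.
apply: derE.
  by apply: derD; apply: der_mulmx; eassumption.
have addE (X Y : 'M[R]_n) : X i j + Y i j = (X + Y) i j by rewrite mxE.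
rewrite addE; congr ((_ : 'M[R]_n) i j).
have -> : geo_omega A t + geo_zeta A t = 2 *: ((A t)^T *m A1 t).
  by rewrite /geo_omega /geo_zeta -/A1 addrACA subrr addr0 scaler_nat mulr2n.
have -> : geo_omega A t - geo_zeta A t = 2 *: ((A1 t)^T *m A t).
  rewrite /geo_omega /geo_zeta -/A1 opprB addrC addrA subrK.
  by rewrite scaler_nat mulr2n.
rewrite -!scalemxAl -!scalemxAr !scalerA /geo_beta.
have -> : (A1 t)^T *m A t *m (invmx (A t) *m (invmx (A t))^T) *m
    ((A t)^T *m A1 t) = (A1 t)^T *m A1 t.
  rewrite !mulmxA -(mulmxA _ (A t)) mulmxV // mulmx1.
  by rewrite -(mulmxA _ (invmx (A t))^T) -trmx_mul mulmxV // trmx1 mulmx1.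
have AA2 : (A t)^T *m A2 t = mu%:M.
  by rewrite A2E -scalemxAr -trmx_mul mulVmx // trmx1 scalemx1.
have A2A : (A2 t)^T *m A t = mu%:M.
  by rewrite -[A t in LHS]trmxK -trmx_mul AA2 tr_scalar_mx.
have -> : 2^-1 * 2 * 2 = 2 :> R by lra.
rewrite AA2 A2A (mulr_natl mu 2) raddfMn scaler_nat !mulr2n.
by rewrite [X in _ + X]addrC addrACA.
Qed.

End MatrixCurves.

(** * The geodesic equations block by block *)

Section BlockDiagonalGeodesics.
Context {R : realType} {m : nat}.
Variables (A : R -> 'M[R]_(2 * m)) (b0 b1 b2 w0 w1 w2 : R -> 'rV[R]_m).
Variable z : 'rV[R]_m.
Hypothesis hA : SL_geodesic A.
Hypothesis hblock : block_diagonal (geo_beta A) (geo_omega A) (geo_zeta A)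
  b0 b1 b2 w0 w1 w2 z.

Lemma diag_block_omega i t : diag_block i (geo_omega A t) =
  mat2 (w0 t 0 i + w1 t 0 i) (w2 t 0 i) (w2 t 0 i) (w0 t 0 i - w1 t 0 i).
Proof.
by have [_ _ -> _] := hblock t; rewrite diag_blockK sym_blockE.
Qed.

(* The [I2], [K2] and [S2] components of the [i]-th block of [A^T A], which is
   the inverse of the [i]-th block of beta. *)
Lemma block_gram i : exists g0 g1 g2 : R -> R, forall t,
  let d := g0 t ^+ 2 - g1 t ^+ 2 - g2 t ^+ 2 in
  [/\ 0 < g0 t /\ d != 0,
      [/\ b0 t 0 i = g0 t / d, b1 t 0 i = - g1 t / d & b2 t 0 i = - g2 t / d]
    & [/\ has_derivative g0 t (w0 t 0 i), has_derivative g1 t (w1 t 0 i)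
        & has_derivative g2 t (w2 t 0 i)]].
Proof.
pose G t := (A t)^T *m A t.
pose g j k t : R := G t (block_index i j) (block_index i k).
have dg j k t : has_derivative (g j k) t (diag_block i (geo_omega A t) j k).
  by rewrite diag_blockE; exact: der_gram.
exists (fun t => 2^-1 * (g 0 0 t + g 1 1 t)),
  (fun t => 2^-1 * (g 0 0 t - g 1 1 t)), (g 0 1) => t d.
have g10 : g 1 0 t = g 0 1 t.
  by rewrite /g -[G t in LHS]trmxK mxE /G trmx_mul trmxK.
(* A diagonal entry of the Gram matrix is the squared norm of a column of [A], which is nonzero
   because [A] is invertible. *)
have g_gt0 j : 0 < g j j t.
  have : 0 <= g j j t.
    by rewrite /g /G mxE sumr_ge0 // => k _; rewrite mxE -expr2 sqr_ge0.
  rewrite le_eqVlt => /orP[/eqP/esym|//]; rewrite /g /G mxE.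
  move=> S0; have A0 k : A t k (block_index i j) = 0.
    apply/eqP; rewrite -sqrf_eq0 expr2.
    have -> : A t k (block_index i j) * A t k (block_index i j) =
        (A t)^T (block_index i j) k * A t k (block_index i j) by rewrite mxE.
    apply/eqP; apply: (psumr_eq0P _ S0) => // l _.
    by rewrite mxE -expr2 sqr_ge0.
  have /matrixP/(_ (block_index i j) (block_index i j)) :=
    mulVmx (geodesic_unit hA t).
  rewrite !mxE eqxx big1 => [/eqP|k _]; last by rewrite A0 mulr0.
  by rewrite eq_sym oner_eq0.
have : diag_block i (G t *m geo_beta A t) = 1%:M.
  by rewrite gram_beta // diag_block_scalar.
have [-> _ _ _] := hblock t.
rewrite diag_blockMr sym_blockE [diag_block _ _]mat2_eta.
rewrite mat2M mat2_1 !diag_blockE -!/(g _ _ t) g10 => /mat2_inj.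
move: (b0 t 0 i) (b1 t 0 i) (b2 t 0 i) => x y u.
have := g_gt0 0; have := g_gt0 1; rewrite /d /= => {d}.
move: (g 0 0 t) (g 1 1 t) (g 0 1 t) => p q s q_gt0 p_gt0 [e1 e2 e3 e4].
(* [D] is the determinant of the Gram block. Cramer's rule solves [e1] to [e4] for the block of
   beta, and [D * (x + y) = q > 0] shows that [D] is nonzero. *)
set D := _ - s ^+ 2. have DE : D = p * q - s ^+ 2 by rewrite /D; field.
have Dxy : D * (x + y) = q.
  have : q * (p * (x + y) + s * u) - s * (s * (x + y) + q * u) = q.
    by rewrite e1 e3; ring.
  by move=> E; rewrite DE -[RHS]E; ring.
have Dxy' : D * (x - y) = p.
  have : p * (s * u + q * (x - y)) - s * (p * u + s * (x - y)) = p.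
    by rewrite e2 e4; ring.
  by move=> E; rewrite DE -[RHS]E; ring.
have Du : D * u = - s.
  have : p * (s * (x + y) + q * u) - s * (p * (x + y) + s * u) = - s.
    by rewrite e1 e3; ring.
  by move=> E; rewrite DE -[RHS]E; ring.
have D0 : D != 0.
  apply/eqP => D0; move: Dxy; rewrite D0 mul0r => q0.
  by move: q_gt0; rewrite -q0 ltxx.
split; first by split=> //; lra.
  by split; apply: (mulfI D0); rewrite [RHS]mulrC divfK //; lra.
split.
- apply: derE; first by apply: derM; [exact: derC|apply: derD; exact: dg].
  by rewrite /= diag_block_omega mat2_00 mat2_11; field.
- apply: derE.
    apply: derM; first exact: derC.
    by apply: derD; [|apply: derN]; exact: dg.
  by rewrite /= diag_block_omega mat2_00 mat2_11; field.
- by apply: derE; [exact: dg|rewrite diag_block_omega mat2_01].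
Qed.

(** The multiple of the identity enters only the [I2] component. The right-hand sides for [w1] and
    [w2] are linear and homogeneous in [k], [s], [y], [u], with coefficients depending on the
    solution. For [w0], the term [e] is made explicit only on scalar blocks. *)
Lemma block_system : exists mu : R -> R, forall i t,
  let q := b0 t 0 i in let k := b1 t 0 i in let s := b2 t 0 i in
  let x := w0 t 0 i in let y := w1 t 0 i in let u := w2 t 0 i in
  let c := z 0 i in
  [/\ exists2 e, has_derivative (fun t => w0 t 0 i) t (2^-1 * e + mu t) &
        k = 0 -> s = 0 -> y = 0 -> u = 0 -> e = q * (x ^+ 2 + c ^+ 2),
      has_derivative (fun t => w1 t 0 i) t
        (2^-1 * ((x ^+ 2 + y ^+ 2 - u ^+ 2 - c ^+ 2) * k
         + (2 * y * u + 2 * c * x) * s + 2 * x * q * y + 2 * c * q * u))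
    & has_derivative (fun t => w2 t 0 i) t
        (2^-1 * ((2 * y * u - 2 * c * x) * k
         + (u ^+ 2 + x ^+ 2 - c ^+ 2 - y ^+ 2) * s - 2 * c * q * y
         + 2 * x * q * u))].
Proof.
have /choice [mu dmu] := der_omega hA.
exists mu => i t q k s x y u c.
(* The three factors are the blocks of [omega - zeta], [beta] and [omega + zeta]; the added zeros
   are the diagonal of the block of zeta. *)
have dw j l : has_derivative (fun s => diag_block i (geo_omega A s) j l) t
  ((2^-1 *: (mat2 (x + y - 0) (u - (- c)) (u - c) (x - y - 0) *m
             mat2 (q + k) s s (q - k) *m
             mat2 (x + y + 0) (u - c) (u + c) (x - y + 0)) + (mu t)%:M) j l).
  under eq_fun do rewrite diag_blockE.
  apply: derE; first exact: dmu.
  rewrite -diag_blockE diag_blockD diag_block_scalar diag_blockZ.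
  have [-> -> -> _] := hblock t; rewrite /sym_blocks /skew_blocks.
  rewrite blocks2N !blocks2D diag_blockMr diag_blockMl diag_blockK.
  rewrite /= !sym_blockE !skew_blockE. by rewrite mat2N !mat2D.
move: dw; rewrite mat2_1 !mat2M mat2Z mat2D => dw.
have := dw 0 0; have := dw 0 1; have := dw 1 1.
under eq_fun do rewrite diag_block_omega mat2_11.
under [X in _ -> has_derivative X _ _ -> _]eq_fun do
  rewrite diag_block_omega mat2_01.
under [X in _ -> _ -> has_derivative X _ _ -> _]eq_fun do
  rewrite diag_block_omega mat2_00.
rewrite mat2_00 mat2_01 mat2_11 => d11 d01 d00.
split.
(* The [I2] component is half the trace of the block; below, the [K2] component is half the
   difference of the diagonal entries. *)
- eexists.
    have -> : (fun t => w0 t 0 i) = fun t => 2^-1 *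
        ((w0 t 0 i + w1 t 0 i) + (w0 t 0 i - w1 t 0 i)).
      by apply/funext => v; field.
    apply: derE.
      by apply: derM; [exact: derC|apply: derD; [exact: d00|exact: d11]].
    have E p p' : 2^-1 * (2^-1 * p + mu t + (2^-1 * p' + mu t)) =
      2^-1 * (2^-1 * (p + p')) + mu t by field.
    by rewrite mul0r add0r E.
  by move=> -> -> -> ->; field.
- have -> : (fun t => w1 t 0 i) = fun t => 2^-1 *
      ((w0 t 0 i + w1 t 0 i) - (w0 t 0 i - w1 t 0 i)).
    by apply/funext => v; field.
  apply: derE.
    apply: derM; first exact: derC.
    by apply: derD; [exact: d00|apply: derN; exact: d11].
  by move: (mu t) => ?; field.
- by apply: derE; [exact: d01|field].
Qed.

End BlockDiagonalGeodesics.

(** * Persistence of scalar blocks and of equalities between blocks *)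

Section ScalarBlocks.
Context {R : realType} {m : nat}.
Variables (A : R -> 'M[R]_(2 * m)) (b0 b1 b2 w0 w1 w2 : R -> 'rV[R]_m).
Variable z : 'rV[R]_m.
Hypothesis hA : SL_geodesic A.
Hypothesis hblock : block_diagonal (geo_beta A) (geo_omega A) (geo_zeta A)
  b0 b1 b2 w0 w1 w2 z.

(** For each block, [g1], [g2], [w1], [w2] solve a homogeneous linear system: [g1' = w1] and
    [g2' = w2], while the other two equations become linear in these unknowns once [b1 = - g1 / D]
    and [b2 = - g2 / D] are substituted. *)
Lemma scalar_blocks t0 :
  [/\ b1 t0 = 0, w1 t0 = 0, b2 t0 = 0 & w2 t0 = 0] ->
  forall t, [/\ b1 t = 0, w1 t = 0, b2 t = 0 & w2 t = 0].
Proof.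
move=> [b1t0 w1t0 b2t0 w2t0] t.
suff H i : [/\ b1 t 0 i = 0, w1 t 0 i = 0, b2 t 0 i = 0 & w2 t 0 i = 0].
  by split; apply/rowP => i; rewrite mxE; have [] := H i.
have [mu /(_ i) sys] := block_system hA hblock.
have [g0 [g1 [g2 gram]]] := block_gram hA hblock i.
have dg0 u : has_derivative g0 u (w0 u 0 i) by have [_ _ []] := gram u.
have dg1 u : has_derivative g1 u (w1 u 0 i) by have [_ _ []] := gram u.
have dg2 u : has_derivative g2 u (w2 u 0 i) by have [_ _ []] := gram u.
pose D u := g0 u ^+ 2 - g1 u ^+ 2 - g2 u ^+ 2.
have D0 u : D u != 0 by have [[]] := gram u.
have b0E u : b0 u 0 i = g0 u / D u by have [_ []] := gram u.
have b1E u : b1 u 0 i = - g1 u / D u by have [_ []] := gram u.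
have b2E u : b2 u 0 i = - g2 u / D u by have [_ []] := gram u.
pose x u := w0 u 0 i; pose y u := w1 u 0 i; pose v u := w2 u 0 i.
have cx : continuous x.
  by move=> u; have [[e de _] _ _] := sys u; exact: der_continuous_at de.
have cy : continuous y.
  by move=> u; have [_ de _] := sys u; exact: der_continuous_at de.
have cv : continuous v.
  by move=> u; have [_ _ de] := sys u; exact: der_continuous_at de.
have cg0 := der_continuous dg0; have cg1 := der_continuous dg1.
have cg2 := der_continuous dg2.
have cD : continuous D by rewrite /D; cont.
pose c := z 0 i.
pose Y (k : 'I_4) := nth (fun=> 0) [:: g1; g2; y; v] k.
pose M (j k : 'I_4) := nth (fun=> 0) (nth [::]
  [:: [:: fun=> 0; fun=> 0; fun=> 1; fun=> 0];
      [:: fun=> 0; fun=> 0; fun=> 0; fun=> 1];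
      [:: fun u => - (2^-1 * (x u ^+ 2 + y u ^+ 2 - v u ^+ 2 - c ^+ 2)
                      * (D u)^-1);
          fun u => - ((y u * v u + c * x u) * (D u)^-1);
          fun u => x u * g0 u * (D u)^-1; fun u => c * g0 u * (D u)^-1];
      [:: fun u => - ((y u * v u - c * x u) * (D u)^-1);
          fun u => - (2^-1 * (v u ^+ 2 + x u ^+ 2 - c ^+ 2 - y u ^+ 2)
                      * (D u)^-1);
          fun u => - (c * g0 u * (D u)^-1);
          fun u => x u * g0 u * (D u)^-1]] j) k.
have Y0 : forall k u, Y k u = 0.
  apply: (linear_ode_eq0 (x := Y) (M := M) (t0 := t0)).
  - by case=> [[|[|[|[|//]]]] j4]; case=> [[|[|[|[|//]]]] k4];
      rewrite /M /=; cont.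
  - case=> [[|[|[|[|//]]]] k4] u; rewrite !big_ord_recl big_ord0 /Y /M /=.
    + by apply: derE; [exact: dg1|rewrite -/(y u); ring].
    + by apply: derE; [exact: dg2|rewrite -/(v u); ring].
    + have [_ de _] := sys u; apply: derE; first exact: de.
      rewrite b0E b1E b2E -/(x u) -/(y u) -/(v u) -/c; move: (D0 u).
      move: (D u) (x u) (y u) (v u) (g0 u) (g1 u) (g2 u) => *.
      by field.
    + have [_ _ de] := sys u; apply: derE; first exact: de.
      rewrite b0E b1E b2E -/(x u) -/(y u) -/(v u) -/c; move: (D0 u).
      move: (D u) (x u) (y u) (v u) (g0 u) (g1 u) (g2 u) => *.
      by field.
  - have g10 : g1 t0 = 0.
      apply/eqP; rewrite -oppr_eq0; have /esym/eqP := b1E t0.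
      by rewrite b1t0 mxE mulf_eq0 invr_eq0 (negPf (D0 t0)) orbF.
    have g20 : g2 t0 = 0.
      apply/eqP; rewrite -oppr_eq0; have /esym/eqP := b2E t0.
      by rewrite b2t0 mxE mulf_eq0 invr_eq0 (negPf (D0 t0)) orbF.
    by case=> [[|[|[|[|//]]]] k4]; rewrite /Y /= /y /v ?w1t0 ?w2t0 ?mxE.
have g10 : g1 t = 0 := Y0 (@Ordinal 4 0 isT) t.
have g20 : g2 t = 0 := Y0 (@Ordinal 4 1 isT) t.
split.
- by rewrite b1E g10 oppr0 mul0r.
- exact: (Y0 (@Ordinal 4 2 isT) t).
- by rewrite b2E g20 oppr0 mul0r.
- exact: (Y0 (@Ordinal 4 3 isT) t).
Qed.

Hypothesis hscalar : forall t, [/\ b1 t = 0, w1 t = 0, b2 t = 0 & w2 t = 0].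

Lemma scalar_system : exists mu : R -> R, forall i t,
  [/\ 0 < b0 t 0 i,
      has_derivative (fun t => (b0 t 0 i)^-1) t (w0 t 0 i)
    & has_derivative (fun t => w0 t 0 i) t
        (2^-1 * (b0 t 0 i * (w0 t 0 i ^+ 2 + z 0 i ^+ 2)) + mu t)].
Proof.
have [mu sys] := block_system hA hblock.
exists mu => i t.
have [g0 [g1 [g2 gram]]] := block_gram hA hblock i.
have b0E u : 0 < g0 u /\ b0 u 0 i = (g0 u)^-1.
  have [[g0_gt0 D0] [-> b1E b2E] _] := gram u; split => //.
  have [b1u _ b2u _] := hscalar u.
  move: b1E b2E; rewrite b1u b2u !mxE => /esym/eqP + /esym/eqP.
  rewrite !mulf_eq0 !oppr_eq0 invr_eq0 (negPf D0) !orbF => /eqP -> /eqP ->.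
  by rewrite expr0n /= !subr0; field; rewrite gt_eqF.
have [g0_gt0 b0t] := b0E t; split.
- by rewrite b0t invr_gt0.
- have -> : (fun t => (b0 t 0 i)^-1) = g0.
    by apply/funext => u; have [_ ->] := b0E u; rewrite invrK.
  by have [_ _ []] := gram t.
- have [[e de eE] _ _] := sys i t; have [b1t w1t b2t w2t] := hscalar t.
  by rewrite -eE // ?b1t ?b2t ?w1t ?w2t mxE.
Qed.

Lemma scalar_constraint t : \sum_i b0 t 0 i * w0 t 0 i = 0.
Proof.
have [_ _ _] := hblock t; have [-> _ -> _] := hscalar t.
rewrite /dotv [X in _ + X + _]big1 => [|i _]; last by rewrite mxE mul0r.
by rewrite [X in _ + X]big1 => [|i _]; rewrite ?addr0 // mxE mul0r.
Qed.

(** The common [mu] cancels in the difference of the equations of two blocks, and [z] enters only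
    through its square. With [a = 1 / b0], the differences of the [a] and of the [w0] solve a
    homogeneous linear system. *)
Lemma equal_blocks i j t1 : `|z 0 i| = `|z 0 j| ->
  b0 t1 0 i = b0 t1 0 j -> w0 t1 0 i = w0 t1 0 j ->
  forall t, b0 t 0 i = b0 t 0 j /\ w0 t 0 i = w0 t 0 j.
Proof.
move=> zE bE wE; have [mu sys] := scalar_system.
have zE2 : z 0 i ^+ 2 = z 0 j ^+ 2.
  by rewrite -real_normK ?num_real // zE real_normK ?num_real.
pose a k t := (b0 t 0 k)^-1; pose w k t := w0 t 0 k.
have aE k t : b0 t 0 k = (a k t)^-1 by rewrite invrK.
have a0 k t : a k t != 0.
  by have [b_gt0 _ _] := sys k t; rewrite gt_eqF // invr_gt0.
have da k t : has_derivative (a k) t (w k t) by have [] := sys k t.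
have dw k t : has_derivative (w k) t
    (2^-1 * ((a k t)^-1 * (w k t ^+ 2 + z 0 k ^+ 2)) + mu t).
  by have [] := sys k t; rewrite -aE.
have ca k : continuous (a k) := der_continuous (da k).
have cw k : continuous (w k) := der_continuous (dw k).
have ci := ca i; have cj := ca j; have cwi := cw i; have cwj := cw j.
have i0 := a0 i; have j0 := a0 j.
pose c := z 0 j ^+ 2.
pose x (k : 'I_2) := nth (fun=> 0)
  [:: fun t => a i t - a j t; fun t => w i t - w j t] k.
pose M (k l : 'I_2) := nth (fun=> 0) (nth [::]
  [:: [:: fun=> 0; fun=> 1];
      [:: fun t => - (2^-1 * (w j t ^+ 2 + c) * (a i t)^-1 * (a j t)^-1);
          fun t => 2^-1 * (w i t + w j t) * (a i t)^-1]] k) l.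
have x0 : forall k t, x k t = 0.
  apply: (linear_ode_eq0 (x := x) (M := M) (t0 := t1)).
  - by case=> [[|[|//]] k2]; case=> [[|[|//]] l2]; rewrite /M /=; cont.
  - case=> [[|[|//]] k2] t; rewrite !big_ord_recl big_ord0 /x /M /=.
    + apply: derE; first by apply: derD; [exact: da|apply: derN; exact: da].
      by ring.
    + apply: derE; first by apply: derD; [exact: dw|apply: derN; exact: dw].
      rewrite zE2 -/c; move: (i0 t) (j0 t).
      move: (a i t) (a j t) (w i t) (w j t) (mu t) => *.
      by field; do ?(apply/andP; split).
  - by case=> [[|[|//]] k2]; rewrite /x /= /a /w ?bE ?wE subrr.
move=> t; have /eqP := x0 (@Ordinal 2 0 isT) t.
have /eqP := x0 (@Ordinal 2 1 isT) t.
by rewrite /x /= !subr_eq0 => /eqP wE1 /eqP aE1; rewrite !aE aE1.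
Qed.

End ScalarBlocks.

(** * Elimination of the multiplier *)

Section Reduction.
Context {R : realType}.

(* Differentiating the constraint determines [mu]. *)
Lemma two_body_of_multiplier (r y1 y2 : R) (a1 a2 w1 w2 mu : R -> R) :
  0 < r ->
  (forall t, [/\ 0 < a1 t, has_derivative a1 t (w1 t) & has_derivative w1 t
     (2^-1 * ((a1 t)^-1 * (w1 t ^+ 2 + y1)) + mu t)]) ->
  (forall t, [/\ 0 < a2 t, has_derivative a2 t (w2 t) & has_derivative w2 t
     (2^-1 * ((a2 t)^-1 * (w2 t ^+ 2 + y2)) + mu t)]) ->
  (forall t, r * (w1 t / a1 t) + w2 t / a2 t = 0) ->
  two_body r y1 y2 a1 a2 (fun t => w1 t / a1 t).
Proof.
move=> r_gt0 sys1 sys2 cst t.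
have [a1_gt0 da1 dw1] := sys1 t; have [a2_gt0 da2 dw2] := sys2 t.
have a10 : a1 t != 0 by rewrite gt_eqF.
have a20 : a2 t != 0 by rewrite gt_eqF.
have dv : has_derivative (fun t => w1 t / a1 t) t
    (2^-1 * (y1 / a1 t ^+ 2 - (w1 t / a1 t) ^+ 2) + mu t / a1 t).
  apply: derE.
    by apply: derM; [exact: dw1|apply: derV; [exact: a10|exact: da1]].
  by move: (a1 t) (w1 t) (mu t) a10 => *; field.
have dv2 : has_derivative (fun t => w2 t / a2 t) t
    (2^-1 * (y2 / a2 t ^+ 2 - (w2 t / a2 t) ^+ 2) + mu t / a2 t).
  apply: derE.
    by apply: derM; [exact: dw2|apply: derV; [exact: a20|exact: da2]].
  by move: (a2 t) (w2 t) (mu t) a20 => *; field.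
have w2E : w2 t = - (r * (w1 t / a1 t) * a2 t).
  have E : w2 t / a2 t = - (r * (w1 t / a1 t)) by have := cst t; lra.
  by rewrite -mulNr -E divfK.
have D0 : r * (2^-1 * (y1 / a1 t ^+ 2 - (w1 t / a1 t) ^+ 2) + mu t / a1 t) +
    (2^-1 * (y2 / a2 t ^+ 2 - (w2 t / a2 t) ^+ 2) + mu t / a2 t) = 0.
  have d0 : has_derivative (fun t => r * (w1 t / a1 t) + w2 t / a2 t) t 0.
    by under eq_fun do rewrite cst; exact: derC.
  apply: der_unique d0; apply: derE.
    by apply: derD; [apply: derM; [exact: derC|exact: dv]|exact: dv2].
  by rewrite mul0r add0r.
split => //.
- by apply: derE; [exact: da1|rewrite divfK].
- by apply: derE; [exact: da2|exact: w2E].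
- apply: derE; first exact: dv.
  have M0 : a1 t + r * a2 t != 0 by rewrite gt_eqF // addr_gt0 // mulr_gt0.
  move: D0; rewrite w2E /two_body_force.
  move: (a1 t) (a2 t) (w1 t) (mu t) a10 a20 M0 => a b w u a0 b0 M0 D0.
  (* [D0] is affine in the multiplier [u], with coefficient [r / a + b^-1], which is positive and
     can be divided by. *)
  have -> : u = - (r * (2^-1 * (y1 / a ^+ 2 - (w / a) ^+ 2)) +
     2^-1 * (y2 / b ^+ 2 - (r * (w / a)) ^+ 2)) / (r / a + b^-1).
    have N0 : r / a + b^-1 != 0.
      have -> : r / a + b^-1 = (a + r * b) / (a * b).
        by field; apply/andP.
      by rewrite mulf_neq0 // invr_neq0 // mulf_neq0.
    apply: (canRL (mulfK N0)); apply/eqP.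
    rewrite -subr_eq0 -[X in _ == X]D0; apply/eqP.
    by field; apply/andP.
  by field; do ?(apply/andP; split) => //.
Qed.

End Reduction.

(** * Periodicity of the full solution *)

Unset Implicit Arguments.

Theorem proposition5p7 (R : realType) (m : nat) (A : R -> 'M[R]_(2 * m))
    (b0 b1 b2 w0 w1 w2 : R -> 'rV[R]_m) (z : 'rV[R]_m) (t0 t1 : R) (m0 : nat)
    (hA : SL_geodesic A)
    (hblock : block_diagonal (geo_beta A) (geo_omega A) (geo_zeta A)
                b0 b1 b2 w0 w1 w2 z)
    (hzero : [/\ b1 t0 = 0, w1 t0 = 0, b2 t0 = 0 & w2 t0 = 0])
    (hz : forall i : 'I_m, z 0 i != 0)
    (hm0 : (1 <= m0 < m)%N)
    (hgroups_z : two_groups m0 (map_mx Num.norm z))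
    (hgroups_b : two_groups m0 (b0 t1))
    (hgroups_w : two_groups m0 (w0 t1)) :
  (forall t : R,
     [/\ b1 t = 0, w1 t = 0, b2 t = 0 & w2 t = 0] /\
     two_groups m0 (b0 t) /\ two_groups m0 (w0 t)) /\
  (exists T : R, 0 < T /\
     periodic (geo_beta A) T /\ periodic (geo_omega A) T /\
     periodic (geo_zeta A) T).
Proof.
have hscalar := scalar_blocks hA hblock hzero.
have hgroups (i j : 'I_m) t : (i < m0)%N = (j < m0)%N ->
    b0 t 0 i = b0 t 0 j /\ w0 t 0 i = w0 t 0 j.
  move=> ij; apply: (equal_blocks hA hblock hscalar (t1 := t1)).
  - by have := hgroups_z i j ij; rewrite !mxE.
  - exact: hgroups_b.
  - exact: hgroups_w.
split.
  move=> t; split; first exact: hscalar.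
  by split=> i j /(hgroups i j t)[].
have /andP[m0_gt0 m0m] := hm0.
(* Indices start at 0, so 0 represents the first group and [m0] the second; [p] and [q] are the
   sizes of the groups. *)
pose i1 := Ordinal (ltn_trans m0_gt0 m0m); pose i2 := Ordinal m0m.
pose p : R := #|[pred i : 'I_m | (i < m0)%N]|%:R.
pose q : R := #|[pred i : 'I_m | ~~ (i < m0)%N]|%:R.
have p_gt0 : 0 < p by rewrite ltr0n; apply/card_gt0P; exists i1.
have q_gt0 : 0 < q.
  by rewrite ltr0n; apply/card_gt0P; exists i2; rewrite inE ltnn.
have [mu sys] := scalar_system hA hblock hscalar.
pose a i t := (b0 t 0 i)^-1; pose w i t := w0 t 0 i.
have aE i t : b0 t 0 i = (a i t)^-1 by rewrite invrK.
(* The trace constraint consists of [p] equal terms and [q] equal terms; dividing by [q] gives the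
   two-body constraint with [r = p / q]. *)
have cst t : p / q * (w i1 t / a i1 t) + w i2 t / a i2 t = 0.
  have := scalar_constraint hblock hscalar t.
  rewrite (bigID (fun i : 'I_m => (i < m0)%N)) /=.
  rewrite (eq_bigr (fun=> w i1 t / a i1 t)) => [|i im]; last first.
    have [-> ->] : b0 t 0 i = b0 t 0 i1 /\ w0 t 0 i = w0 t 0 i1.
      by apply: hgroups; rewrite im.
    by rewrite aE mulrC.
  rewrite [X in _ + X](eq_bigr (fun=> w i2 t / a i2 t)) => [|i im]; last first.
    have [-> ->] : b0 t 0 i = b0 t 0 i2 /\ w0 t 0 i = w0 t 0 i2.
      by apply: hgroups; rewrite (negPf im) /= ltnn.
    by rewrite aE mulrC.
  rewrite !sumr_const -mulr_natr -[X in _ + X]mulr_natr -/p -/q => pq.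
  apply: (mulfI (lt0r_neq0 q_gt0)); rewrite mulr0 -pq.
  move: (w i1 t / _) (w i2 t / _) => x y; field.
  exact: lt0r_neq0.
have sysa i t : [/\ 0 < a i t, has_derivative (a i) t (w i t)
    & has_derivative (w i) t
        (2^-1 * ((a i t)^-1 * (w i t ^+ 2 + z 0 i ^+ 2)) + mu t)].
  by have [b_gt0 da dw] := sys i t; split; rewrite ?invr_gt0 // -aE.
have z2_gt0 i : 0 < z 0 i ^+ 2 by rewrite exprn_even_gt0 //= hz.
have r_gt0 : 0 < p / q by rewrite divr_gt0.
have [T [T_gt0 a1T a2T vT]] := two_body_periodic r_gt0 (z2_gt0 i1) (z2_gt0 i2)
  (two_body_of_multiplier r_gt0 (sysa i1) (sysa i2) cst).
have a0 i t : a i t != 0 by have [a_gt0 _ _] := sysa i t; rewrite gt_eqF.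
(* Both velocities are algebraic expressions in [a i1], [a i2] and the logarithmic velocity of
   [a i1], so they inherit the period [T]. *)
have w1E t : w i1 t = w i1 t / a i1 t * a i1 t by rewrite divfK.
have w2E t : w i2 t = - (p / q * (w i1 t / a i1 t)) * a i2 t.
  have <- : w i2 t / a i2 t = - (p / q * (w i1 t / a i1 t)).
    by have := cst t; lra.
  by rewrite divfK.
have w1T t : w i1 (t + T) = w i1 t by rewrite w1E [in RHS]w1E vT a1T.
have w2T t : w i2 (t + T) = w i2 t by rewrite w2E [in RHS]w2E vT a2T.
have per t : b0 (t + T) = b0 t /\ w0 (t + T) = w0 t.
  have : (forall i, b0 (t + T) 0 i = b0 t 0 i /\ w0 (t + T) 0 i = w0 t 0 i).
    move=> i; have [im|im] := boolP (i < m0)%N.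
      have ii1 : (i < m0)%N = (i1 < m0)%N by rewrite im.
      have [-> ->] := hgroups i i1 (t + T) ii1.
      have [-> ->] := hgroups i i1 t ii1.
      by rewrite !aE a1T; split=> //; exact: w1T.
    have ii2 : (i < m0)%N = (i2 < m0)%N by rewrite (negPf im) /= ltnn.
    have [-> ->] := hgroups i i2 (t + T) ii2.
    have [-> ->] := hgroups i i2 t ii2.
    by rewrite !aE a2T; split=> //; exact: w2T.
  by move=> E; split; apply/rowP => i; have [] := E i.
exists T; split=> //; split; [|split] => t.
- have [-> _ _ _] := hblock (t + T); have [-> _ _ _] := hblock t.
  have [-> _ -> _] := hscalar (t + T); have [-> _ -> _] := hscalar t.
  by have [-> _] := per t.
- have [_ _ -> _] := hblock (t + T); have [_ _ -> _] := hblock t.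
  have [_ -> _ ->] := hscalar (t + T); have [_ -> _ ->] := hscalar t.
  by have [_ ->] := per t.
- by have [_ -> _ _] := hblock (t + T); have [_ -> _ _] := hblock t.
Qed.
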